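(* For every integer $k \geq 6$ there exists a pair of $k$-regular cospectral graphs $G_1, G_2$ such that $G_1$ is Hamiltonian and $G_2$ is not Hamiltonian.
   Context: Graphs are finite, simple and undirected. Two graphs are cospectral if their adjacency matrices have the same spectrum (the same eigenvalues with the same multiplicities). A graph is Hamiltonian if it has a cycle of length equal to its number of vertices. *)

(* Defs.v *)
From HB Require Import structures.
From mathcomp Require Import all_boot all_order all_algebra all_field.

Set Implicit Arguments.
Unset Strict Implicit.
Unset Printing Implicit Defensive.

Import GRing.Theory.

Record sgraph := SGraph {
  vertex :> finType;
  edge : rel vertex;
  edge_sym : symmetric edge;
  edge_irrefl : irreflexive edge }.

Arguments edge {G} : rename.

Definition regular (k : nat) (G : sgraph) : Prop :=
  forall x : G, #|[set y : G | edge x y]| = k.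

(* [ucycle] accepts sequences of size 0, 1 and 2, which are not cycles of a
   simple graph. *)
Definition is_cycle (G : sgraph) (s : seq G) : Prop :=
  2 < size s /\ ucycle edge s.

Definition hamiltonian (G : sgraph) : Prop :=
  exists s : seq G, is_cycle s /\ size s = #|G|.

Definition adjmx (R : nzRingType) (G : sgraph) : 'M[R]_#|G| :=
  (\matrix_(i, j) (edge (enum_val i) (enum_val j))%:R)%R.

(* Algebraic multiplicity of [a] as an eigenvalue of [A]; it is 0 exactly when
   [a] is not an eigenvalue of [A]. *)
Definition eig_mult (F : fieldType) n (A : 'M[F]_n) (a : F) : nat :=
  mup a (char_poly A).

(* Adjacency matrices have integer entries, so all their complex eigenvalues
   lie in [algC]. The orders of the two graphs are not assumed equal. *)
Definition cospectral (G1 G2 : sgraph) : Prop :=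
  forall a : algC, eig_mult (adjmx algC G1) a = eig_mult (adjmx algC G2) a.

(* Main.v *)
Require Import Defs.
From mathcomp Require Import all_boot all_order all_algebra all_field zify ring.

(** Let [G2] consist of four pairwise non-adjacent hubs 0, 1, 2, 3, three lobes
and a core, the lobes having neighbours only among the hubs 0, 1, 2, and every
vertex of a lobe or the core seeing no hub or exactly two. Deleting the hubs 0,
1, 2 leaves four components: the lobes, and the core with hub 3. So [G2] is not
Hamiltonian. Godsil-McKay switching with respect to the hubs replaces the pair
of hubs seen by a vertex with the complementary pair; this preserves the
spectrum and, the pairs being suitably balanced, the degrees. Each lobe sees
two pairs, [{a, b}] and [{a, c}] with [{a, b, c} = {0, 1, 2}], which switch to
[{3, c}] and [{3, b}]; in the
switched graph [G1] the lobes and the core can be threaded between consecutive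
hubs as 3, lobe 0, 2, core, 1, lobe 2, 0, lobe 1, 3. Lobes and core are pairs of
cliques joined by a 2-regular bipartite graph, with one vertex of each clique
left unjoined in a lobe. *)

Set Implicit Arguments.
Unset Strict Implicit.
Unset Printing Implicit Defensive.

Import GRing.Theory.

(** * Characteristic polynomials of similar matrices *)

Lemma char_poly_intertwine (F : fieldType) n (A B Q : 'M[F]_n) :
  Q \in unitmx -> (B *m Q = Q *m A)%R -> char_poly A = char_poly B.
Proof.
move=> Qu BQ.
have dQ : (\det (map_mx polyC Q) != 0)%R.
  by rewrite det_map_mx polyC_eq0; rewrite unitmxE unitfE in Qu.
(* Cancel [\det Q] in the determinants of [Q (X - A) = (X - B) Q]. *)
apply: (mulfI dQ); rewrite [RHS]mulrC /char_poly -!det_mulmx; congr (\det _)%R.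
by rewrite /char_poly_mx mulmxBl mulmxBr -!map_mxM BQ -scalar_mxC.
Qed.

(** * Components and Hamiltonian cycles *)

Lemma next_notin_ucycle (T : finType) (s : seq T) (A : {set T}) x y :
  uniq s -> s =i T -> x \in A -> y \notin A ->
  exists2 z, z \in A & next s z \notin A.
Proof.
move=> Us sT xA yA; apply/exists_inP; apply/contraT.
rewrite negb_exists_in => /forall_inP nA.
have nextA z : z \in A -> next s z \in A by move=> /nA/negbNE.
(* A set closed under [next s] would contain the whole orbit of [x], hence [y]. *)
have : fconnect (next s) x y.
  by rewrite (@fconnect_cycle _ _ s) ?sT // cycle_next.
move=> /iter_findex/esym E; move: yA; rewrite E.
suff -> : iter (findex (next s) x y) (next s) x \in A by [].
by elim: findex => //= n /nextA.
Qed.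

(* A Hamiltonian cycle leaves each class of [G - S] through a vertex of [S],
   and distinct classes are left through distinct vertices. *)
Lemma not_hamiltonian (G : sgraph) (S : {set G}) (I : finType) (f : G -> I) :
    (forall x y : G, edge x y -> x \notin S -> y \notin S -> f x = f y) ->
    (forall i, exists2 x, x \notin S & f x = i) ->
  0 < #|S| < #|I| -> ~ hamiltonian G.
Proof.
move=> fE fS /andP[/card_gt0P[y yS] SI] [s [[_ /andP[cs Us]] sG]].
have sT : s =i G.
  apply/subset_cardP; last exact/subsetP.
  by rewrite -sG; apply/card_uniqP.
have hit i : exists z, f z = i /\ (z \notin S) && (next s z \in S).
  have [x xS xi] := fS i.
  have [||z] := @next_notin_ucycle _ s [set z | (z \notin S) && (f z == i)] x y
    Us sT; first by rewrite inE xS xi eqxx.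
    by rewrite inE yS.
  rewrite !inE => /andP[zS /eqP zi]; rewrite negb_and negbK => nz.
  exists z; split=> //; rewrite zS; case/orP: nz => // nzi.
  apply: contraNT nzi => nzS; rewrite -zi; apply/eqP; apply: fE => //.
  by rewrite edge_sym; apply: next_cycle => //; rewrite sT.
have [h hP] := fin_all_exists hit.
have hI : injective (next s \o h).
  move=> i j /(can_inj (prev_next Us)) hij.
  by rewrite -(hP i).1 -(hP j).1 hij.
move: SI; rewrite ltnNge -(card_codom hI) => /negP; apply.
by apply/subset_leq_card/subsetP=> _ /codomP[i ->]; case/andP: (hP i).2.
Qed.

Lemma card_neighbours (G : sgraph) (x : G) :
  #|[set y | edge x y]| = \sum_(y : G) edge x y.
Proof. by rewrite -sum1dep_card big_mkcond; apply: eq_bigr=> y; case: edge. Qed.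

(** * Matrices indexed by a finite type *)

Section KernelMatrix.
Variables (F : nzRingType) (T : finType).
Implicit Types f g : T -> T -> F.
Local Open Scope ring_scope.

(** Working with functions on [T] lets products over [C + D] split into blocks by case analysis. *)
Definition kernel_mx f : 'M[F]_#|T| :=
  \matrix_(i, j) f (enum_val i) (enum_val j).

Lemma mul_kernel_mx f g :
  kernel_mx f *m kernel_mx g = kernel_mx (fun x y => \sum_z f x z * g z y).
Proof.
apply/matrixP=> i j; rewrite !mxE.
rewrite -[RHS](@eq_bigl _ _ _ _ _ (mem T)) // [RHS]big_enum_val.
by apply: eq_bigr => l _; rewrite !mxE.
Qed.

Lemma eq_kernel_mx f g : f =2 g -> kernel_mx f = kernel_mx g.
Proof. by move=> fg; apply/matrixP=> i j; rewrite !mxE fg. Qed.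

Lemma sum_mul_delta (f : T -> F) y :
  \sum_z f z * (z == y)%:R = f y.
Proof.
rewrite (bigD1 y) //= eqxx mulr1 big1 ?addr0 // => z /negPf ->.
by rewrite mulr0.
Qed.

End KernelMatrix.

(** * Godsil-McKay switching *)

Section HubGraph.
Variables (C D : finType) (e : rel D).
Hypotheses (e_sym : symmetric e) (e_irr : irreflexive e).

Definition hub_edge (L : D -> pred C) : rel (C + D) := fun x y =>
  match x, y with
  | inl c, inr d => L d c
  | inr d, inl c => L d c
  | inr d, inr d' => e d d'
  | inl _, inl _ => false
  end.

Lemma hub_edge_sym L : symmetric (hub_edge L).
Proof. by move=> [c|d] [c'|d'] //=; apply: e_sym. Qed.

Lemma hub_edge_irr L : irreflexive (hub_edge L).
Proof. by case=> //=; apply: e_irr. Qed.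

Definition hub_graph L := SGraph (@hub_edge_sym L) (@hub_edge_irr L).

Lemma hub_regular k (L : D -> pred C) :
    (forall c, \sum_d L d c = k) ->
    (forall d, \sum_c L d c + \sum_d' e d d' = k) ->
  regular k (hub_graph L).
Proof.
move=> kC kD [c|d]; rewrite card_neighbours big_sumType /= /index_enum /=.
  by rewrite big1 ?kC.
exact: kD.
Qed.

Import Num.Theory.
Local Open Scope ring_scope.

(** The Godsil-McKay matrix: diagonal blocks [(2/m) J - I] on [C] and [I] on [D], with [m = #|C|]
    and [J] all ones. *)
Definition gm_kernel (F : fieldType) (x y : C + D) : F :=
  match x, y with
  | inl c, inl c' => 2%:R / #|C|%:R - (c == c')%:R
  | inr d, inr d' => (d == d')%:R
  | _, _ => 0
  end.

(* The hypothesis says that each vertex of [D] sees none, half or all of [C]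
   through [L1], and that [L2] complements [L1] in the second case only. *)
Lemma gm_cospectral (L1 L2 : D -> pred C) :
    (0 < #|C|)%N ->
    (forall d c, #|C| * (L1 d c + L2 d c) = 2 * \sum_c' L1 d c')%N ->
  cospectral (hub_graph L1) (hub_graph L2).
Proof.
move=> C0 H a; congr (mup a _).
have m0 : (#|C|%:R : algC) != 0 by rewrite pnatr_eq0 -lt0n.
have E (L : D -> pred C) d : \sum_c (L d c)%:R = (\sum_c L d c)%N%:R :> algC.
  by rewrite natr_sum.
have HR d c : #|C|%:R * ((L1 d c)%:R + (L2 d c)%:R) =
    2 * \sum_c' (L1 d c')%:R :> algC.
  by rewrite E -natrD -!natrM H.
(* Sum the hypothesis over [c] and cancel [#|C|]. *)
have L12 (d : D) : \sum_c (L2 d c)%:R = \sum_c (L1 d c)%:R :> algC.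
  have : \sum_c #|C|%:R * ((L1 d c)%:R + (L2 d c)%:R) =
      \sum_(c : C) 2 * \sum_c' (L1 d c')%:R :> algC.
    by apply: eq_bigr => c _; rewrite HR.
  rewrite -mulr_sumr sumr_const big_split /= -[RHS]mulr_natl => /(mulfI m0).
  by rewrite mulrDl !mul1r => /addrI.
have HL2 d c :
  (L2 d c)%:R = 2%:R / #|C|%:R * (\sum_c' (L1 d c')%:R) - (L1 d c)%:R :> algC.
  by apply: (mulfI m0); rewrite mulrBr mulrA [_ * (_ / _)]mulrC divfK // -(HR d c); ring.
pose Q := kernel_mx (@gm_kernel algC).
(* [Q] is an involution because [J^2 = m J]. *)
have QQ : Q *m Q = 1%:M.
  rewrite mul_kernel_mx; apply/matrixP=> i j; rewrite !mxE.
  rewrite -(inj_eq enum_val_inj) big_sumType /=.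
  case: (enum_val i) (enum_val j) => [c|d] [c'|d'] /=.
  - rewrite [X in _ + X]big1 ?addr0 => [|d _]; last by rewrite mul0r.
    under eq_bigr => z _ do rewrite mulrBr.
    rewrite sumrB sum_mul_delta -mulr_suml sumrB sumr_const.
    rewrite -[\sum_z _]mulr1 mulr_suml.
    under [\sum_z _]eq_bigr => z _ do rewrite mulrC eq_sym.
    rewrite sum_mul_delta -[X in X - 1]mulr_natr divfK //.
    rewrite (inj_eq inl_inj); ring.
  - by rewrite !big1 ?addr0 // => z _; rewrite ?mulr0 ?mul0r.
  - by rewrite !big1 ?addr0 // => z _; rewrite ?mulr0 ?mul0r.
  - rewrite big1 ?add0r => [|c _]; last by rewrite mulr0.
    by rewrite sum_mul_delta.
have Qu : Q \in unitmx by case: (mulmx1_unit QQ).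
apply: (char_poly_intertwine Qu).
rewrite -[adjmx _ (hub_graph L1)]/(kernel_mx (fun x y => (hub_edge L1 x y)%:R)).
rewrite -[adjmx _ (hub_graph L2)]/(kernel_mx (fun x y => (hub_edge L2 x y)%:R)).
(* The intertwining relation is compared block by block; only the two mixed blocks involve the
   links, through [HL2] and [L12]. *)
rewrite !mul_kernel_mx; apply: eq_kernel_mx => -[c|d] [c'|d'].
all: rewrite !big_sumType /=.
- by rewrite !big1 ?addr0 // => z _; rewrite ?mulr0 ?mul0r.
- rewrite big1 ?add0r => [|z _]; last by rewrite mul0r.
  rewrite [X in _ = _ + X]big1 ?addr0 => [|z _]; last by rewrite mul0r.
  rewrite sum_mul_delta.
  under [RHS]eq_bigr => z _ do rewrite mulrBl.
  rewrite sumrB -mulr_sumr HL2; congr (_ - _).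
  rewrite -[LHS](sum_mul_delta (fun z => (L1 d' z)%:R)).
  by apply: eq_bigr => z _; rewrite eq_sym mulrC.
- rewrite [X in _ + X]big1 ?addr0 => [|z _]; last by rewrite mulr0.
  rewrite [X in _ = X + _]big1 ?add0r => [|z _]; last by rewrite mul0r.
  under [LHS]eq_bigr => z _ do rewrite mulrBr.
  rewrite sumrB sum_mul_delta -mulr_suml L12 HL2 mulrC opprB addrC subrK.
  by under eq_bigr => z _ do rewrite eq_sym mulrC; rewrite sum_mul_delta.
- rewrite [X in X + _]big1 ?add0r => [|z _]; last by rewrite mulr0.
  rewrite [X in _ = X + _]big1 ?add0r => [|z _]; last by rewrite mul0r.
  rewrite sum_mul_delta.
  by under eq_bigr => z _ do rewrite eq_sym mulrC; rewrite sum_mul_delta.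
Qed.

End HubGraph.

Lemma big_option (R : Type) (idx : R) (op : Monoid.com_law idx) (T : finType)
    (F : option T -> R) :
  \big[op/idx]_x F x = op (F None) (\big[op/idx]_x F (Some x)).
Proof.
rewrite (bigD1 None) //=; congr (op _ _).
rewrite (reindex_omap (op := op) Some id) /=; last by case.
by apply: eq_bigl => x; rewrite eqxx.
Qed.

Lemma big_prod (R : Type) (idx : R) (op : Monoid.com_law idx) (I J : finType)
    (F : I * J -> R) :
  \big[op/idx]_p F p = \big[op/idx]_i \big[op/idx]_j F (i, j).
Proof. by rewrite pair_bigA; apply: eq_bigr => -[]. Qed.

(** * Pairs of cliques and their spanning paths *)

Section CliquePair.
Variables (T : finType) (r : rel T).

(** [r] is always read from the [false] clique to the [true] one, so it may be asymmetric. *)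
Definition clique_pair : rel (T * bool) := fun x y =>
  if x.2 == y.2 then x.1 != y.1 else if x.2 then r y.1 x.1 else r x.1 y.1.

Lemma clique_pair_sym : symmetric clique_pair.
Proof. by case=> x [] [y []]; rewrite /clique_pair //= eq_sym. Qed.

Lemma clique_pair_irr : irreflexive clique_pair.
Proof. by case=> x b; rewrite /clique_pair /= !eqxx. Qed.

Lemma clique_pair_degree x b :
  \sum_y clique_pair (x, b) y =
  #|T|.-1 + \sum_y (if b then r y x else r x y).
Proof.
have E : \sum_y (x != y) = #|T|.-1.
  rewrite -(cardC1 x) -sum1_card [RHS]big_mkcond /=.
  by apply: eq_bigr => y _; rewrite inE /= eq_sym; case: eqP.
rewrite big_prod -E -big_split; apply: eq_bigr => y _.
by rewrite big_bool /clique_pair /=; case: b => //=; rewrite addnC.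
Qed.

(** The tail of a walk from [(x, b)]: through one clique, across at the last vertex, then back in
    reverse to [(x, ~~ b)]. *)
Definition clique_pair_walk x (s : seq T) b :=
  [seq (y, b) | y <- s] ++ [seq (y, ~~ b) | y <- rev (x :: s)].

Lemma size_clique_pair_walk x s b :
  size (clique_pair_walk x s b) = (size s + size s).+1.
Proof. by rewrite size_cat !size_map size_rev addnS. Qed.

Lemma mem_clique_pair_walk x s b :
  x :: s =i T -> (x, b) :: clique_pair_walk x s b =i {: T * bool}.
Proof.
move=> sT [y c]; rewrite -cat_cons mem_cat inE.
have [->|/negPf cb] := eqVneq c b.
  by apply/orP; left; apply: (@map_f _ _ (fun z => (z, b)) (x :: s)); rewrite sT.
have -> : c = ~~ b by case: c b cb => [] [].
by apply/orP; right; apply: map_f; rewrite mem_rev sT.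
Qed.

Lemma last_clique_pair_walk x s b : last (x, b) (clique_pair_walk x s b) = (x, ~~ b).
Proof. by rewrite last_cat rev_cons map_rcons last_rcons. Qed.

(** Inside a clique every duplicate-free sequence is a path; [r] is used only at the single
    crossing. *)
Lemma path_clique_pair_walk x s b :
  uniq (x :: s) -> r (last x s) (last x s) ->
  path clique_pair (x, b) (clique_pair_walk x s b).
Proof.
have side c y t : uniq (y :: t) -> path clique_pair (y, c) [seq (z, c) | z <- t].
  rewrite uniq_pairwise => /pairwise_sorted /=.
  rewrite path_map; apply: sub_path => z z'.
  by rewrite /clique_pair /= eqxx.
move=> Us rl; rewrite cat_path side //= (last_map (fun y => (y, b))).
have : uniq (rev (x :: s)) by rewrite rev_uniq.
rewrite lastI rev_rcons => Ur /=; rewrite side // andbT.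
by rewrite /clique_pair /=; case: b; rewrite rl.
Qed.

End CliquePair.

(** Addition is cyclic, so the bipartite graph is an even cycle; its diagonal edges serve as
    crossings. *)
Definition succ_rel n : rel 'I_n.+2 := fun x y => (y == x) || (y == x + 1)%R.

Lemma succ_rel_degree n (x : 'I_n.+2) b :
  \sum_y (if b then succ_rel y x else succ_rel x y) = 2.
Proof.
transitivity (\sum_(y in [set x; if b then (x - 1)%R else (x + 1)%R]) 1).
  rewrite [RHS]big_mkcond; apply: eq_bigr => y _; rewrite !inE /succ_rel.
  case: b; last by case: (_ || _).
  by rewrite [y == x]eq_sym [y == _]eq_sym subr_eq; case: (_ || _).
rewrite sum1_card cards2.
have -> //: x != (if b then x - 1 else x + 1)%R.
by case: b; rewrite -subr_eq0 opprD ?opprK addNKr ?oppr_eq0 oner_eq0.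
Qed.

Definition option_rel (T : Type) (r : rel T) : rel (option T) := fun x y =>
  match x, y with Some x, Some y => r x y | _, _ => false end.

(** * The two graphs *)

Section Construction.
Variable q : nat.
Notation k := q.+4.+2.
Notation lobe := (option 'I_q.+4 * bool)%type.
Notation core := ('I_q.+3 * bool)%type.
Notation pieces := ('I_3 * lobe + core)%type.

Definition piece_edge : rel pieces := fun x y =>
  match x, y with
  | inl (i, u), inl (j, v) =>
      (i == j) && clique_pair (option_rel (@succ_rel q.+2)) u v
  | inr u, inr v => clique_pair (@succ_rel q.+1) u v
  | _, _ => false
  end.

Lemma piece_edge_sym : symmetric piece_edge.
Proof.
move=> [[i u]|u] [[j v]|v] //=; last exact: clique_pair_sym.
by rewrite eq_sym clique_pair_sym.
Qed.

Lemma piece_edge_irr : irreflexive piece_edge.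
Proof.
by move=> [[i u]|u] /=; rewrite clique_pair_irr ?andbF.
Qed.

(* The hubs seen in the Hamiltonian graph; each two core vertices with the same
   [3 <= j] add 1 to the degree of every hub, which makes the degree [k]. *)
Definition attach (d : pieces) : seq nat :=
  match d with
  | inl (i, (Some _, _)) => [::]
  | inl (i, (None, false)) => [:: 3; nth 0 [:: 2; 2; 1] i]
  | inl (i, (None, true)) => [:: 3; nth 0 [:: 1; 0; 0] i]
  | inr (j, false) =>
      nth [:: 2; 3] [:: [:: 0; 2]; [:: 0; 1]; [:: 0; 2]] j
  | inr (j, true) =>
      nth [:: 0; 1] [:: [:: 0; 1]; [:: 1; 2]; [:: 1; 2]] j
  end.

Definition link d : pred 'I_4 := fun c => (c : nat) \in attach d.
(** Switching is an involution; here it leads from the Hamiltonian graph to the other one. *)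
Definition switched_link d : pred 'I_4 := fun c =>
  (attach d != [::]) && ((c : nat) \notin attach d).

Lemma attach_degree d :
  \sum_c link d c = size (attach d) /\ \sum_c switched_link d c = size (attach d).
Proof.
split; rewrite !big_ord_recl big_ord0 /link /switched_link.
all: case: d => [[[[|[|[|i]]] ?] [[x|] []]]|[[[|[|[|j]]] ?] []]] //=.
all: by rewrite nth_default.
Qed.

(** A lobe vertex has [q + 4] neighbours in its clique and two across or two hubs; a core vertex has
    [q + 2], two across and two hubs. *)
Lemma piece_degree d : size (attach d) + \sum_d' piece_edge d d' = k.
Proof.
rewrite big_sumType /=; case: d => [[i u]|[j b]].
  rewrite [X in _ + (_ + X)]big1 // addn0.
  rewrite big_prod (bigD1 i) // [X in _ + (_ + X)]big1 ?addn0 => [|i' /negPf ii']; last first.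
    by apply: big1 => u' _ /=; rewrite eq_sym ii'.
  case: u => [x b]; under eq_bigr => v _ do rewrite /= eqxx /=.
  rewrite clique_pair_degree big_option card_option card_ord.
  case: x => [x|] /=; last by case: b; rewrite big1 // !addn0.
  by rewrite succ_rel_degree add0n; case: b; rewrite add0n !addnS addn0.
rewrite [X in _ + (X + _)]big1 ?add0n; last by case.
rewrite clique_pair_degree succ_rel_degree card_ord.
have -> : size (attach (inr (j, b))) = 2.
  by case: j b => [[|[|[|j]]] ?] [] //=; rewrite nth_default.
by rewrite addn2 add2n.
Qed.

(** For [link], the lobes give 6 to hub 3 and 2 to the others, core indices below 3 give 0 and 4,
    the other [q] give 1 each. Every hub lies in half of all pairs, so complementing keeps the
    totals. *)
Lemma hub_degree (c : 'I_4) : \sum_d link d c = k /\ \sum_d switched_link d c = k.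
Proof.
have Q1 : \sum_(j < q) 1 = q by rewrite sum1_card card_ord.
split; rewrite big_sumType !big_prod !big_ord_recl big_ord0 !big_prod.
all: rewrite !big_option !big_bool /= ![\sum_(i < q.+4) _]big1 //.
all: try by move=> x _; rewrite big_bool.
all: rewrite (eq_bigr (fun=> 1)) ?Q1.
all: move: c => [[|[|[|[|c]]]] ltc] //.
all: by move=> j _; rewrite big_bool /link /switched_link /= !nth_nil.
Qed.

Definition ham_graph := hub_graph piece_edge_sym piece_edge_irr link.
Definition switched_graph := hub_graph piece_edge_sym piece_edge_irr switched_link.

Lemma ham_graph_regular : regular k ham_graph.
Proof.
apply: hub_regular => [c|d]; first by case: (hub_degree c).
by have [-> _] := attach_degree d; apply: piece_degree.
Qed.

Lemma switched_graph_regular : regular k switched_graph.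
Proof.
apply: hub_regular => [c|d]; first by case: (hub_degree c).
by have [_ ->] := attach_degree d; apply: piece_degree.
Qed.

Lemma ham_switched_cospectral :
  cospectral ham_graph switched_graph.
Proof.
apply: gm_cospectral; rewrite card_ord // => d c.
have [-> _] := attach_degree d; rewrite /link /switched_link.
case: d => [[[[|[|[|i]]] ?] [[x|] []]]|[[[|[|[|j]]] ?] []]] //=.
all: by rewrite ?nth_default //; case: (_ \in _).
Qed.

Lemma switched_graph_not_hamiltonian :
  ~ hamiltonian switched_graph.
Proof.
pose S := [set x : 'I_4 + pieces | if x is inl c then c < 3 else false].
pose f (x : 'I_4 + pieces) : option 'I_3 :=
  if x is inr (inl (i, _)) then Some i else None.
apply: (@not_hamiltonian switched_graph S _ f).
(* The only hub outside [S] is 3, and every nonempty lobe pair in [attach] contains 3, so no lobe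
   sees it after switching. *)
- have E c d : switched_link d c -> inl c \notin S -> f (inl c) = f (inr d).
    rewrite inE /switched_link => /andP[dn cd] c3.
    case: d dn cd => [[i [[x|] b]]|] //= _.
    case: c c3 => [[|[|[|[|c]]]] ?] //= _.
    by case: b; rewrite inE.
  move=> [c|d] [c'|d'] //=; first by move=> dc cS _; exact: E dc cS.
    by move=> dc _ cS; exact: esym (E _ _ dc cS).
  by case: d d' => [[i u]|u] [[j v]|v] //= /andP[/eqP-> _].
- case=> [i|]; first by exists (inr (inl (i, (None, true)))); rewrite ?inE.
  by exists (inr (inr (ord0, true))); rewrite ?inE.
- have -> : #|S| = 3.
    rewrite -sum1_card big_mkcond big_sumType /= [X in _ + X]big1 => [|d _].
      by rewrite !big_ord_recl big_ord0 !inE.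
    by rewrite inE.
  by rewrite card_option card_ord.
Qed.

Lemma ham_graph_hamiltonian :
  hamiltonian ham_graph.
Proof.
pose G : sgraph := ham_graph.
pose sA := [seq Some x | x <- enum 'I_q.+4].
pose sB := [seq lift ord0 x | x <- enum 'I_q.+2].
pose A (i : 'I_3) b : seq G :=
  [seq inr (inl (i, u)) | u <- (None, b) :: clique_pair_walk None sA b].
pose B : seq G :=
  [seq inr (inr u) | u <- (ord0, false) :: clique_pair_walk ord0 sB false].
pose h i : G := inl (inord i).
(* Each Boolean picks the [None] vertex by which a lobe is entered, so that its two ends see the
   hubs before and after it. *)
pose s : seq G :=
  [:: h 3] ++ A ord0 true ++ [:: h 2] ++ B ++
  [:: h 1] ++ A ord_max false ++ [:: h 0] ++ A (inord 1) true.
have sizeA i b : size (A i b) = (q.+4.+1).*2.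
  by rewrite size_map /= size_clique_pair_walk size_map size_enum_ord addnn doubleS.
have sizeB : size B = (q.+3).*2.
  by rewrite size_map /= size_clique_pair_walk size_map size_enum_ord addnn doubleS.
have sizeG : size s = #|G|.
  rewrite /s !(size_cat, sizeA, sizeB).
  rewrite !(card_sum, card_prod) card_option card_bool !card_ord !muln2 mulSn mul2n.
  by rewrite /=; lia.
have sA_full : None :: sA =i {: option 'I_q.+4}.
  move=> [x|] //; rewrite inE /=; apply: map_f; exact: mem_enum.
have sB_full : ord0 :: sB =i 'I_q.+3.
  by move=> x; rewrite -enum_ordSl mem_enum.
have inA i b u : inr (inl (i, u)) \in A i b.
  apply: (map_f (fun u => inr (inl (i, u)) : G)).
  by rewrite mem_clique_pair_walk.
have inB u : inr (inr u) \in B.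
  apply: (map_f (fun u => inr (inr u) : G)).
  by rewrite mem_clique_pair_walk.
have s_full x : x \in s.
  rewrite /s !mem_cat; case: x => [c|[[i u]|u]]; last by rewrite inB !orbT.
    have -> : inl c = h c by rewrite /h inord_val.
    by case: (nat_of_ord c) (ltn_ord c) => [|[|[|[|m]]]] // _;
      rewrite !mem_seq1 eqxx ?orbT.
  have [||] : [\/ i = ord0, i = ord_max | i = inord 1].
    by case: i => [[|[|[|i]]] lti] //; [apply: Or31|apply: Or33|apply: Or32];
      apply: ord_inj; rewrite /= ?inordK.
  - by move=> ->; apply/orP; right; apply/orP; left; apply: inA.
  - by move=> ->; do 5![apply/orP; right]; apply/orP; left; apply: inA.
  - by move=> ->; do 7![apply/orP; right]; apply: inA.
(* A sequence covering [G] with only [#|G|] entries has no repetition. *)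
have Us : uniq s.
  apply: (leq_size_uniq (enum_uniq G)) => [x _|]; first exact: s_full.
  by rewrite sizeG cardE.
exists s; split=> //; split; first by rewrite sizeG -sizeG /s size_cat size_cat sizeA.
rewrite /ucycle Us andbT.
have lastA : last None sA = Some ord_max.
  by rewrite /sA enum_ordSr map_rcons last_rcons.
have pathA i b : path (@edge G) (inr (inl (i, (None, b))))
    [seq inr (inl (i, u)) | u <- clique_pair_walk None sA b].
  rewrite (path_map (f := fun u => inr (inl (i, u)) : G)).
  rewrite (eq_path (e' := clique_pair (option_rel (@succ_rel q.+2)))).
    apply: path_clique_pair_walk; rewrite ?lastA /= /succ_rel ?eqxx //.
    rewrite map_inj_uniq ?enum_uniq ?andbT => [|? ? [] //].
    by apply/mapP => -[].
  by move=> u v /=; rewrite eqxx.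
have pathB : path (@edge G) (inr (inr (ord0, false)))
    [seq inr (inr u) | u <- clique_pair_walk ord0 sB false].
  rewrite (path_map (f := fun u => inr (inr u) : G)).
  apply: path_clique_pair_walk; last by rewrite /succ_rel eqxx.
  by rewrite -enum_ordSl enum_uniq.
have segA i b c c' t : edge c (inr (inl (i, (None, b))) : G) ->
    edge (inr (inl (i, (None, ~~ b))) : G) c' -> path edge c' t ->
    path edge c (A i b ++ c' :: t).
  move=> ec ec' et.
  suff : path (@edge G) (inr (inl (i, (None, b))))
      ([seq inr (inl (i, u)) | u <- clique_pair_walk None sA b] ++ c' :: t).
    by move=> H; apply/andP.
  rewrite cat_path pathA (last_map (fun u => inr (inl (i, u)) : G)).
  by rewrite last_clique_pair_walk; apply/andP; split=> //; apply/andP.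
have segB c c' t : edge c (inr (inr (ord0, false)) : G) ->
    edge (inr (inr (ord0, true)) : G) c' -> path edge c' t ->
    path edge c (B ++ c' :: t).
  move=> ec ec' et.
  suff : path (@edge G) (inr (inr (ord0, false)))
      ([seq inr (inr u) | u <- clique_pair_walk ord0 sB false] ++ c' :: t).
    by move=> H; apply/andP.
  rewrite cat_path pathB (last_map (fun u => inr (inr u) : G)).
  by rewrite last_clique_pair_walk; apply/andP; split=> //; apply/andP.
(* The cycle becomes a path from hub 3 back to hub 3, checked one piece at a time. *)
rewrite /s cat1s /cycle -cats1 -!catA !cat1s.
apply: (segA); [by rewrite /= /link /= inordK..|].
apply: segB; [by rewrite /= /link /= inordK..|].
apply: (segA); [by rewrite /= /link /= inordK..|].
by apply: (segA); rewrite //= /link /= !inordK.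
Qed.
End Construction.

Theorem theorem3 : forall k : nat, 6 <= k ->
  exists G1 G2 : sgraph,
    [/\ regular k G1, regular k G2, cospectral G1 G2,
        hamiltonian G1 & ~ hamiltonian G2].
Proof.
case=> [|[|[|[|[|[|q]]]]]] // _.
exists (ham_graph q).
exists (switched_graph q).
split.
- exact: ham_graph_regular.
- exact: switched_graph_regular.
- exact: ham_switched_cospectral.
- exact: ham_graph_hamiltonian.
- exact: switched_graph_not_hamiltonian.
Qed.
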